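(* Let $\mathcal{A}$ be a vector space over a field $\mathcal{K}$ of characteristic zero, let $\Delta:\mathcal{A}\to\mathcal{A}\otimes\mathcal{A}\otimes\mathcal{A}$ be a linear map and let $\alpha_1,\alpha_2:\mathcal{A}\to\mathcal{A}$ be linear maps. Let $\Delta^*:\mathcal{A}^*\otimes\mathcal{A}^*\otimes\mathcal{A}^*\to\mathcal{A}^*$ and $\alpha_i^*:\mathcal{A}^*\to\mathcal{A}^*$ be the dual maps. Then: (1) $(\mathcal{A},\Delta,(\alpha_i)_{i=1,2})$ is a partially hom-coassociative ternary coalgebra if and only if $(\mathcal{A}^*,\Delta^*,(\alpha_i^* )_{i=1,2})$ is a partially hom-associative ternary algebra. (2) $(\mathcal{A},\Delta,(\alpha_i)_{i=1,2})$ is a totally hom-coassociative ternary coalgebra if and only if $(\mathcal{A}^*,\Delta^*,(\alpha_i^* )_{i=1,2})$ is a totally hom-associative ternary algebra. (3) $(\mathcal{A},\Delta,(\alpha_i)_{i=1,2})$ is a weak totally hom-coassociative ternary coalgebra if and only if $(\mathcal{A}^*,\Delta^*,(\alpha_i^* )_{i=1,2})$ is a weak totally hom-associative ternary algebra.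
   Context: Dual maps: $\mathcal{A}^*$ is the dual space, $\langle\xi,x\rangle=\xi(x)$, $\langle\alpha^*(f),x\rangle=\langle f,\alpha(x)\rangle$, and $\langle\Delta^*(\xi,\eta,\gamma),x\rangle=\langle\xi\otimes\eta\otimes\gamma,\Delta(x)\rangle$, where $\langle\xi\otimes\eta\otimes\gamma,x\otimes y\otimes z\rangle=\langle\xi,x\rangle\langle\eta,y\rangle\langle\gamma,z\rangle$. Algebras: let $B$ be a vector space with a trilinear operation $\mu:B\otimes B\otimes B\to B$ and linear maps $\alpha_1,\alpha_2:B\to B$. For $x_1,\dots,x_5\in B$ put $P_1=\mu(\mu(x_1\otimes x_2\otimes x_3)\otimes\alpha_1(x_4)\otimes\alpha_2(x_5))$, $P_2=\mu(\alpha_1(x_1)\otimes\mu(x_2\otimes x_3\otimes x_4)\otimes\alpha_2(x_5))$, $P_3=\mu(\alpha_1(x_1)\otimes\alpha_2(x_2)\otimes\mu(x_3\otimes x_4\otimes x_5))$. Then $(B,\mu,(\alpha_i)_{i=1,2})$ is a totally hom-associative ternary algebra if $P_1=P_2=P_3$ for all $x_1,\dots,x_5$; a weak totally hom-associative ternary algebra if $P_1=P_3$ for all $x_1,\dots,x_5$; a partially hom-associative ternary algebra if $P_1+P_2+P_3=0$ for all $x_1,\dots,x_5$. Coalgebras: let $C$ be a vector space with linear maps $\Delta:C\to C\otimes C\otimes C$, $\alpha_1,\alpha_2:C\to C$. Then $(C,\Delta,(\alpha_i)_{i=1,2})$ is a totally hom-coassociative ternary coalgebra if $(\Delta\otimes\alpha_1\otimes\alpha_2)\circ\Delta=(\alpha_1\otimes\Delta\otimes\alpha_2)\circ\Delta=(\alpha_1\otimes\alpha_2\otimes\Delta)\circ\Delta$;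 a weak totally hom-coassociative ternary coalgebra if $(\Delta\otimes\alpha_1\otimes\alpha_2)\circ\Delta=(\alpha_1\otimes\alpha_2\otimes\Delta)\circ\Delta$; a partially hom-coassociative ternary coalgebra if $(\Delta\otimes\alpha_1\otimes\alpha_2+\alpha_1\otimes\Delta\otimes\alpha_2+\alpha_1\otimes\alpha_2\otimes\Delta)\circ\Delta=0$. *)

(* Defs.v *)
From HB Require Import structures.
From mathcomp Require Import all_boot all_algebra.
From mathcomp Require Import boolp.
From mathcomp.multinomials Require Import freeg.

Set Implicit Arguments.
Unset Strict Implicit.
Unset Printing Implicit Defensive.

Import GRing.Theory.
Local Open Scope ring_scope.
Local Open Scope quotient_scope.

Lemma fglift_is_linear (K : fieldType) (X : choiceType) (V : lmodType K)
  (f : X -> V) : linear (fglift f : {freeg X / K} -> V).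
Proof.
have fgD D1 D2 : fglift f (D1 + D2) = fglift f D1 + fglift f D2.
  have B := @lift_is_additive K X V f.
  have /= f0 := B 0 0; rewrite !subrr in f0.
  by rewrite -[D2 in LHS]opprK -[- D2 in LHS]sub0r !B f0 sub0r opprK.
have fg0 : fglift f 0 = 0.
  by have := @lift_is_additive K X V f 0 0; rewrite !subrr.
move=> a D1 D2; rewrite fgD; congr (_ + _).
rewrite -[D1 in LHS]freeg_sumE -[D1 in RHS]freeg_sumE scaler_sumr.
rewrite !(big_morph _ fgD fg0) scaler_sumr; apply: eq_bigr => x _.
have -> : a *: << coeff x D1 *g x >> = << a * coeff x D1 *g x >> :> {freeg X / K}.
  by apply/eqP/freeg_eqP => y; rewrite coeffZ !coeffU mulrA.
by rewrite !liftU scalerA.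
Qed.

HB.instance Definition _ (K : fieldType) (X : choiceType) (V : lmodType K)
    (f : X -> V) :=
  GRing.isLinear.Build K {freeg X / K} V _ (fglift f) (fglift_is_linear f).

(* Tensor product of two vector spaces: the free vector space on U * V modulo *)
(* the subspace spanned by the bilinearity relators.                          *)
Section TensorConstruction.
Variables (K : fieldType) (U V : lmodType K).

Local Notation free := {freeg (U * V)%type / K}.

Inductive tensor_relations : free -> Prop :=
| tensor_rel0 : tensor_relations 0
| tensor_relP a x y :
    tensor_relations x -> tensor_relations y -> tensor_relations (a *: x + y)
| tensor_rell a u1 u2 v :
    tensor_relations (<<(a *: u1 + u2, v)>> - (a *: <<(u1, v)>> + <<(u2, v)>>))
| tensor_relr a u v1 v2 :
    tensor_relations (<<(u, a *: v1 + v2)>> - (a *: <<(u, v1)>> + <<(u, v2)>>)).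

Definition tensor_ker : {pred free} := fun x => `[< tensor_relations x >].

Lemma tensor_ker_zmod_closed : zmod_closed tensor_ker.
Proof.
split=> [|x y /asboolP Rx /asboolP Ry]; apply/asboolP; first exact: tensor_rel0.
by rewrite addrC -scaleN1r; exact: tensor_relP.
Qed.

HB.instance Definition _ :=
  GRing.isZmodClosed.Build free tensor_ker tensor_ker_zmod_closed.

Definition tensor_quot := Quotient.quot tensor_ker.

HB.instance Definition _ := GRing.Zmodule.on tensor_quot.
HB.instance Definition _ := Quotient.on tensor_quot.

Definition tensor_pi (x : free) : tensor_quot := \pi_tensor_quot x.

Lemma tensor_piW (P : tensor_quot -> Prop) :
  (forall x, P (tensor_pi x)) -> forall t, P t.
Proof. exact: quotW. Qed.

Lemma tensor_piP (x y : free) :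
  tensor_pi x = tensor_pi y <-> tensor_relations (x - y).
Proof.
have E : (x - y \in tensor_ker) = (tensor_pi x == tensor_pi y).
  exact: (Quotient.idealrBE tensor_ker).
by split=> [/eqP|/asboolP R]; [rewrite -E => /asboolP|apply/eqP; rewrite -E].
Qed.

Lemma tensor_piD (x y : free) : tensor_pi (x + y) = tensor_pi x + tensor_pi y.
Proof. exact: (Quotient.pi_add tensor_ker). Qed.

Definition tensor_scale (a : K) (t : tensor_quot) : tensor_quot :=
  tensor_pi (a *: repr t).

Lemma tensor_pi_repr (t : tensor_quot) : tensor_pi (repr t) = t.
Proof. exact: reprK. Qed.

Lemma tensor_scale_pi a (x : free) :
  tensor_scale a (tensor_pi x) = tensor_pi (a *: x).
Proof.
apply/tensor_piP; rewrite -scalerBr -[_ *: _]addr0.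
apply: tensor_relP; last exact: tensor_rel0.
by apply/tensor_piP; rewrite tensor_pi_repr.
Qed.

Lemma tensor_scaleA a b t :
  tensor_scale a (tensor_scale b t) = tensor_scale (a * b) t.
Proof. by elim/tensor_piW: t => x; rewrite !tensor_scale_pi scalerA. Qed.

Lemma tensor_scale1 : left_id 1 tensor_scale.
Proof. by elim/tensor_piW => x; rewrite tensor_scale_pi scale1r. Qed.

Lemma tensor_scaleDr : right_distributive tensor_scale +%R.
Proof.
move=> a; elim/tensor_piW=> x; elim/tensor_piW=> y.
by rewrite -tensor_piD !tensor_scale_pi scalerDr tensor_piD.
Qed.

Lemma tensor_scaleDl t : {morph tensor_scale^~ t : a b / a + b}.
Proof.
elim/tensor_piW: t => x a b.
by rewrite !tensor_scale_pi scalerDl tensor_piD.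
Qed.

HB.instance Definition _ := GRing.Zmodule_isLmodule.Build K tensor_quot
  tensor_scaleA tensor_scale1 tensor_scaleDr tensor_scaleDl.

Lemma tensor_pi_is_linear : linear tensor_pi.
Proof. by move=> a x y; rewrite tensor_piD -tensor_scale_pi. Qed.

HB.instance Definition _ :=
  GRing.isLinear.Build K free tensor_quot _ tensor_pi tensor_pi_is_linear.

Definition quot_tens (u : U) (v : V) : tensor_quot := tensor_pi <<(u, v)>>.

Lemma quot_tensPl a u1 u2 v :
  quot_tens (a *: u1 + u2) v = a *: quot_tens u1 v + quot_tens u2 v.
Proof. by rewrite /quot_tens -linearP; apply/tensor_piP/tensor_rell. Qed.

Lemma quot_tensPr a u v1 v2 :
  quot_tens u (a *: v1 + v2) = a *: quot_tens u v1 + quot_tens u v2.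
Proof. by rewrite /quot_tens -linearP; apply/tensor_piP/tensor_relr. Qed.

Lemma quot_tens_ind (P : tensor_quot -> Prop) :
  P 0 -> (forall a s t, P s -> P t -> P (a *: s + t)) ->
  (forall u v, P (quot_tens u v)) -> forall t, P t.
Proof.
move=> P0 PP Pt t; elim/tensor_piW: t => x; rewrite -[x]freeg_sumE.
elim: (dom x) => [|[u v] s IHs]; first by rewrite big_nil linear0.
rewrite big_cons; set a := coeff _ _.
have -> : << a *g (u, v) >> = a *: <<(u, v)>> :> free.
  by apply/eqP/freeg_eqP => y; rewrite coeffZ !coeffU mul1r.
by rewrite linearP; apply: PP => //; apply: Pt.
Qed.

Section QuotLift.
Variables (W : lmodType K) (b : {bilinear U -> V -> W}).

Definition quot_lift (t : tensor_quot) : W :=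
  fglift (fun x => b x.1 x.2) (repr t).

Lemma quot_lift_pi (x : free) :
  quot_lift (tensor_pi x) = fglift (fun x => b x.1 x.2) x.
Proof.
rewrite /quot_lift; apply/eqP; rewrite -subr_eq0 -linearB; apply/eqP.
have : tensor_relations (repr (tensor_pi x) - x).
  by apply/tensor_piP; rewrite tensor_pi_repr.
elim=> [|a y z _ Fy _ Fz|a u1 u2 v|a u v1 v2].
- exact: linear0.
- by rewrite linearP Fy Fz /= scaler0 addr0.
- by rewrite linearB linearP /= !liftU !scale1r linearPl subrr.
- by rewrite linearB linearP /= !liftU !scale1r linearPr subrr.
Qed.

Lemma quot_lift_is_linear : linear quot_lift.
Proof.
move=> a; elim/tensor_piW=> x; elim/tensor_piW=> y.
by rewrite -linearP !quot_lift_pi linearP.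
Qed.

Lemma quot_liftE u v : quot_lift (quot_tens u v) = b u v.
Proof. by rewrite quot_lift_pi liftU scale1r. Qed.

End QuotLift.

End TensorConstruction.

(* The universal property: bilinear maps factor linearly through tp_tens, and  *)
(* uniquely so because pure tensors span (tp_ind).                             *)
Record tensor_product (K : fieldType) (U V : lmodType K) := TensorProduct {
  tp_space : lmodType K;
  tp_tens : U -> V -> tp_space;
  tp_tensPl : forall a u1 u2 v,
    tp_tens (a *: u1 + u2) v = a *: tp_tens u1 v + tp_tens u2 v;
  tp_tensPr : forall a u v1 v2,
    tp_tens u (a *: v1 + v2) = a *: tp_tens u v1 + tp_tens u v2;
  tp_ind : forall P : tp_space -> Prop,
    P 0 -> (forall a s t, P s -> P t -> P (a *: s + t)) ->
    (forall u v, P (tp_tens u v)) -> forall t, P t;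
  tp_lift : forall W : lmodType K, {bilinear U -> V -> W} -> tp_space -> W;
  tp_lift_linear : forall (W : lmodType K) (b : {bilinear U -> V -> W}),
    linear (tp_lift b);
  tp_liftE : forall (W : lmodType K) (b : {bilinear U -> V -> W}) u v,
    tp_lift b (tp_tens u v) = b u v
}.

(* Locked: unfolding the quotient makes the unification of module structures   *)
(* on iterated tensor products very slow.                                      *)
Fact tensor_key : unit. Proof. exact: tt. Qed.

Definition the_tensor_product (K : fieldType) (U V : lmodType K) :
    tensor_product U V :=
  locked_with tensor_key (TensorProduct
    (@quot_tensPl K U V) (@quot_tensPr K U V) (@quot_tens_ind K U V)
    (@quot_lift_is_linear K U V) (@quot_liftE K U V)).

Section TensorProduct.
Variables (K : fieldType) (U V : lmodType K).

Definition tensor : lmodType K := tp_space (the_tensor_product U V).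

Definition tens : U -> V -> tensor := tp_tens (the_tensor_product U V).

Lemma tensPl a u1 u2 v : tens (a *: u1 + u2) v = a *: tens u1 v + tens u2 v.
Proof. exact: tp_tensPl. Qed.

Lemma tensPr a u v1 v2 : tens u (a *: v1 + v2) = a *: tens u v1 + tens u v2.
Proof. exact: tp_tensPr. Qed.

Lemma tens_is_bilinear : bilinear_for
  (GRing.Scale.Law.clone _ _ *:%R _) (GRing.Scale.Law.clone _ _ *:%R _) tens.
Proof. by split=> [v|u] a x y; [exact: tensPl|exact: tensPr]. Qed.

HB.instance Definition _ :=
  bilinear_isBilinear.Build K U V tensor _ _ tens tens_is_bilinear.

HB.instance Definition _ (u : U) :=
  GRing.isLinear.Build K V tensor _ (tens u) (tens_is_bilinear.2 u).

Lemma tens_ind (P : tensor -> Prop) :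
  P 0 -> (forall a s t, P s -> P t -> P (a *: s + t)) ->
  (forall u v, P (tens u v)) -> forall t, P t.
Proof. exact: tp_ind. Qed.

Lemma tens_ext (W : lmodType K) (f g : {linear tensor -> W}) :
  (forall u v, f (tens u v) = g (tens u v)) -> f =1 g.
Proof.
move=> fg; elim/tens_ind => [|a s t fs ft|//]; first by rewrite !linear0.
by rewrite !linearP fs ft.
Qed.

Section Lift.
Variables (W : lmodType K) (b : {bilinear U -> V -> W}).

Definition tensor_lift : tensor -> W :=
  @tp_lift K U V (the_tensor_product U V) W b.

Lemma tensor_lift_is_linear : linear tensor_lift.
Proof. exact: tp_lift_linear. Qed.

HB.instance Definition _ :=
  GRing.isLinear.Build K tensor W _ tensor_lift tensor_lift_is_linear.

Lemma tensor_liftE u v : tensor_lift (tens u v) = b u v.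
Proof. exact: tp_liftE. Qed.

End Lift.

End TensorProduct.

Notation "U ⊗ V" := (tensor U V) (at level 40, left associativity) : type_scope.
Notation "u ⊗ v" := (tens u v) (at level 40, left associativity) : ring_scope.

Section TensorMaps.
Variables (K : fieldType).

Section Map.
Variables (U V U' V' : lmodType K).
Variables (f : {linear U -> U'}) (g : {linear V -> V'}).

Definition tensor_map_bil (u : U) (v : V) : U' ⊗ V' := f u ⊗ g v.

Lemma tensor_map_is_bilinear : bilinear_for
  (GRing.Scale.Law.clone _ _ *:%R _) (GRing.Scale.Law.clone _ _ *:%R _)
  tensor_map_bil.
Proof.
by split=> [v|u] a x y; rewrite /tensor_map_bil linearP ?tensPl ?tensPr.
Qed.

HB.instance Definition _ := bilinear_isBilinear.Build K U V (U' ⊗ V')%type _ _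
  tensor_map_bil tensor_map_is_bilinear.

Definition tensor_map : (U ⊗ V)%type -> (U' ⊗ V')%type :=
  tensor_lift tensor_map_bil.

HB.instance Definition _ := GRing.isLinear.Build K (U ⊗ V)%type (U' ⊗ V')%type _
  tensor_map (tensor_lift_is_linear tensor_map_bil).

Lemma tensor_mapE u v : tensor_map (u ⊗ v) = f u ⊗ g v.
Proof. exact: tensor_liftE. Qed.

End Map.

(* u ⊗ (v ⊗ w) |-> (u ⊗ v) ⊗ w *)
Section Assoc.
Variables (U V W : lmodType K).

Definition tensor_assoc_bil (u : U) : (V ⊗ W)%type -> (U ⊗ V ⊗ W)%type :=
  tensor_map (tens u) idfun.

Lemma tensor_assoc_is_bilinear : bilinear_for
  (GRing.Scale.Law.clone _ _ *:%R _) (GRing.Scale.Law.clone _ _ *:%R _)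
  tensor_assoc_bil.
Proof.
split=> [t|u] a x y; rewrite /tensor_assoc_bil /=; last exact: linearP.
pose g : {linear _ -> _} :=
  a \*: tensor_map (@tens K U V x) (@idfun W) \+ tensor_map (@tens K U V y) (@idfun W).
apply: (tens_ext (f := tensor_map (@tens K U V (a *: x + y)) (@idfun W)) (g := g)).
by move=> v w; rewrite /g /= !tensor_mapE /= !tensPl.
Qed.

HB.instance Definition _ := bilinear_isBilinear.Build K U (V ⊗ W)%type
  (U ⊗ V ⊗ W)%type _ _ tensor_assoc_bil tensor_assoc_is_bilinear.

Definition tensor_assoc : (U ⊗ (V ⊗ W))%type -> (U ⊗ V ⊗ W)%type :=
  tensor_lift tensor_assoc_bil.

HB.instance Definition _ := GRing.isLinear.Build K
  (U ⊗ (V ⊗ W))%type (U ⊗ V ⊗ W)%type _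
  tensor_assoc (tensor_lift_is_linear tensor_assoc_bil).

Lemma tensor_assocE u v w : tensor_assoc (u ⊗ (v ⊗ w)) = u ⊗ v ⊗ w.
Proof. by rewrite /tensor_assoc tensor_liftE /= /tensor_assoc_bil tensor_mapE. Qed.

End Assoc.

(* u ⊗ ((v ⊗ w) ⊗ x) |-> ((u ⊗ v) ⊗ w) ⊗ x *)
Definition tensor_assoc3 (U V W X : lmodType K) :
    (U ⊗ (V ⊗ W ⊗ X))%type -> (U ⊗ V ⊗ W ⊗ X)%type :=
  tensor_map (@tensor_assoc U V W) (@idfun X) \o @tensor_assoc U (V ⊗ W)%type X.

HB.instance Definition _ (U V W X : lmodType K) :=
  GRing.Linear.copy (@tensor_assoc3 U V W X)
    (tensor_map (@tensor_assoc U V W) (@idfun X) \o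
     @tensor_assoc U (V ⊗ W)%type X).

Lemma tensor_assoc3E (U V W X : lmodType K) (u : U) (v : V) (w : W) (x : X) :
  tensor_assoc3 (u ⊗ (v ⊗ w ⊗ x)) = u ⊗ v ⊗ w ⊗ x.
Proof. by rewrite /tensor_assoc3 /= tensor_assocE tensor_mapE /= tensor_assocE. Qed.

End TensorMaps.

Section Dual.
Variables (K : fieldType) (V : lmodType K).

Definition dual_space := {linear V -> K^o}.

HB.instance Definition _ := gen_eqMixin dual_space.
HB.instance Definition _ := gen_choiceMixin dual_space.

Lemma dual_spaceP (f g : dual_space) : (forall x, f x = g x) -> f = g.
Proof.
case: f g => [f [[mf] [sf]]] [g [[mg] [sg]]] /= fg.
have {fg} efg : f = g by apply/funext.
subst g.
by rewrite (Prop_irrelevance mf mg) (Prop_irrelevance sf sg).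
Qed.

Definition dual_zero : dual_space := \0.
Definition dual_opp (f : dual_space) : dual_space := \- f.
Definition dual_add (f g : dual_space) : dual_space := f \+ g.
Definition dual_scale (a : K) (f : dual_space) : dual_space := a \*: f.

Lemma dual_addA : associative dual_add.
Proof. by move=> f g h; apply: dual_spaceP => x; apply: addrA. Qed.

Lemma dual_addC : commutative dual_add.
Proof. by move=> f g; apply: dual_spaceP => x; apply: addrC. Qed.

Lemma dual_add0 : left_id dual_zero dual_add.
Proof. by move=> f; apply: dual_spaceP => x; apply: add0r. Qed.

Lemma dual_addN : left_inverse dual_zero dual_opp dual_add.
Proof. by move=> f; apply: dual_spaceP => x; apply: addNr. Qed.

HB.instance Definition _ :=
  GRing.isZmodule.Build dual_space dual_addA dual_addC dual_add0 dual_addN.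

Lemma dual_scaleA a b f :
  dual_scale a (dual_scale b f) = dual_scale (a * b) f.
Proof. by apply: dual_spaceP => x; apply: mulrA. Qed.

Lemma dual_scale1 : left_id 1 dual_scale.
Proof. by move=> f; apply: dual_spaceP => x; apply: mul1r. Qed.

Lemma dual_scaleDr : right_distributive dual_scale +%R.
Proof. by move=> a f g; apply: dual_spaceP => x; apply: mulrDr. Qed.

Lemma dual_scaleDl f : {morph dual_scale^~ f : a b / a + b}.
Proof. by move=> a b; apply: dual_spaceP => x; apply: mulrDl. Qed.

HB.instance Definition _ := GRing.Zmodule_isLmodule.Build K dual_space
  dual_scaleA dual_scale1 dual_scaleDr dual_scaleDl.

Definition dual : lmodType K := dual_space.

Definition pairing (f : dual) (x : V) : K := (f : dual_space) x.

Lemma dualP (f g : dual) : (forall x, pairing f x = pairing g x) -> f = g.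
Proof. exact: dual_spaceP. Qed.

Lemma pairingPl a f g x :
  pairing (a *: f + g) x = a * pairing f x + pairing g x.
Proof. by []. Qed.

Lemma pairingPr f a x y :
  pairing f (a *: x + y) = a * pairing f x + pairing f y.
Proof. exact: (linearP (f : dual_space)). Qed.

End Dual.

Section DualMap.
Variables (K : fieldType) (U V : lmodType K) (alpha : {linear U -> V}).

Definition dual_map (f : dual V) : dual U :=
  ((f : dual_space V) \o alpha : dual_space U).

Lemma dual_mapE f x : pairing (dual_map f) x = pairing f (alpha x).
Proof. by []. Qed.

Lemma dual_map_is_linear : linear dual_map.
Proof. by move=> a f g; apply: dualP. Qed.

HB.instance Definition _ :=
  GRing.isLinear.Build K (dual V) (dual U) _ dual_map dual_map_is_linear.

End DualMap.

(* The canonical map V^* ⊗ W^* -> (V ⊗ W)^*, reading ξ ⊗ η as the functional   *)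
(* x ⊗ y |-> ξ(x) η(y).                                                        *)
Section DualTensor.
Variables (K : fieldType) (V W : lmodType K).

Definition prod_fun (f : dual V) (g : dual W) (v : V) (w : W) : K^o :=
  pairing f v * pairing g w.

Lemma prod_fun_is_bilinear f g : bilinear_for
  (GRing.Scale.Law.clone _ _ *:%R _) (GRing.Scale.Law.clone _ _ *:%R _)
  (prod_fun f g).
Proof.
split=> [w|v] a x y; rewrite /prod_fun pairingPr.
  by rewrite mulrDl -mulrA.
by rewrite mulrDr mulrCA.
Qed.

HB.instance Definition _ f g := bilinear_isBilinear.Build K V W K^o _ _
  (prod_fun f g) (prod_fun_is_bilinear f g).

Definition dual_tensor_bil (f : dual V) (g : dual W) : dual (V ⊗ W)%type :=
  tensor_lift (prod_fun f g).

Lemma dual_tensor_bilE f g v w :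
  pairing (dual_tensor_bil f g) (v ⊗ w) = pairing f v * pairing g w.
Proof. exact: (tensor_liftE (prod_fun f g)). Qed.

Lemma dual_tensor_ext (f g : dual (V ⊗ W)%type) :
  (forall v w, pairing f (v ⊗ w) = pairing g (v ⊗ w)) -> f = g.
Proof. by move=> fg; apply/dualP/(@tens_ext K V W K^o f g). Qed.

Lemma dual_tensor_is_bilinear : bilinear_for
  (GRing.Scale.Law.clone _ _ *:%R _) (GRing.Scale.Law.clone _ _ *:%R _)
  dual_tensor_bil.
Proof.
split=> [g|f] a x y; apply: dual_tensor_ext => v w.
  by rewrite pairingPl !dual_tensor_bilE pairingPl mulrDl mulrA.
by rewrite pairingPl !dual_tensor_bilE pairingPl mulrDr mulrCA.
Qed.

HB.instance Definition _ := bilinear_isBilinear.Build K (dual V) (dual W)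
  (dual (V ⊗ W)%type) _ _ dual_tensor_bil dual_tensor_is_bilinear.

Definition dual_tensor : (dual V ⊗ dual W)%type -> dual (V ⊗ W)%type :=
  tensor_lift dual_tensor_bil.

HB.instance Definition _ := GRing.isLinear.Build K
  (dual V ⊗ dual W)%type (dual (V ⊗ W)%type) _
  dual_tensor (tensor_lift_is_linear dual_tensor_bil).

Lemma dual_tensorE f g v w :
  pairing (dual_tensor (f ⊗ g)) (v ⊗ w) = pairing f v * pairing g w.
Proof. by rewrite /dual_tensor tensor_liftE dual_tensor_bilE. Qed.

End DualTensor.

Section DualTensor3.
Variables (K : fieldType) (A : lmodType K).
Local Notation A' := (dual A).

Definition dual_tensor3 : (A' ⊗ A' ⊗ A')%type -> dual (A ⊗ A ⊗ A)%type :=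
  @dual_tensor K (A ⊗ A)%type A \o tensor_map (@dual_tensor K A A) (@idfun A').

HB.instance Definition _ := GRing.Linear.copy dual_tensor3
  (@dual_tensor K (A ⊗ A)%type A \o tensor_map (@dual_tensor K A A) (@idfun A')).

Lemma dual_tensor3E (f g h : A') (x y z : A) :
  pairing (dual_tensor3 (f ⊗ g ⊗ h)) (x ⊗ y ⊗ z) =
  pairing f x * pairing g y * pairing h z.
Proof. by rewrite /dual_tensor3 /= tensor_mapE /= !dual_tensorE. Qed.

(* The dual map Δ^*: <Δ^*(ξ, η, γ), x> = <ξ ⊗ η ⊗ γ, Δ(x)>. *)
Definition dual_comul (Delta : {linear A -> (A ⊗ A ⊗ A)%type}) :
    (A' ⊗ A' ⊗ A')%type -> A' :=
  dual_map Delta \o dual_tensor3.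

HB.instance Definition _ Delta := GRing.Linear.copy (dual_comul Delta)
  (dual_map Delta \o dual_tensor3).

Lemma dual_comulE Delta (t : (A' ⊗ A' ⊗ A')%type) x :
  pairing (dual_comul Delta t) x = pairing (dual_tensor3 t) (Delta x).
Proof. by []. Qed.

End DualTensor3.

Section TernaryHomAlgebras.
Variables (K : fieldType) (B : lmodType K).
Variables (mu : {linear (B ⊗ B ⊗ B)%type -> B}) (alpha1 alpha2 : {linear B -> B}).
Implicit Types x : B.

Definition hom_assoc1 x1 x2 x3 x4 x5 : B :=
  mu (mu (x1 ⊗ x2 ⊗ x3) ⊗ alpha1 x4 ⊗ alpha2 x5).
Definition hom_assoc2 x1 x2 x3 x4 x5 : B :=
  mu (alpha1 x1 ⊗ mu (x2 ⊗ x3 ⊗ x4) ⊗ alpha2 x5).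
Definition hom_assoc3 x1 x2 x3 x4 x5 : B :=
  mu (alpha1 x1 ⊗ alpha2 x2 ⊗ mu (x3 ⊗ x4 ⊗ x5)).

Definition totally_hom_associative : Prop :=
  forall x1 x2 x3 x4 x5,
    hom_assoc1 x1 x2 x3 x4 x5 = hom_assoc2 x1 x2 x3 x4 x5 /\
    hom_assoc2 x1 x2 x3 x4 x5 = hom_assoc3 x1 x2 x3 x4 x5.

Definition weak_totally_hom_associative : Prop :=
  forall x1 x2 x3 x4 x5,
    hom_assoc1 x1 x2 x3 x4 x5 = hom_assoc3 x1 x2 x3 x4 x5.

Definition partially_hom_associative : Prop :=
  forall x1 x2 x3 x4 x5,
    hom_assoc1 x1 x2 x3 x4 x5 + hom_assoc2 x1 x2 x3 x4 x5 +
    hom_assoc3 x1 x2 x3 x4 x5 = 0.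

End TernaryHomAlgebras.

(* The maps Δ ⊗ α1 ⊗ α2, α1 ⊗ Δ ⊗ α2 and α1 ⊗ α2 ⊗ Δ have different codomains *)
(* until tensor products are reassociated; all three are brought to the        *)
(* left-nested fivefold tensor product.                                        *)
Section TernaryHomCoalgebras.
Variables (K : fieldType) (C : lmodType K).
Variables (Delta : {linear C -> (C ⊗ C ⊗ C)%type}) (alpha1 alpha2 : {linear C -> C}).

Definition hom_coassoc1 : (C ⊗ C ⊗ C)%type -> (C ⊗ C ⊗ C ⊗ C ⊗ C)%type :=
  tensor_map (tensor_map Delta alpha1) alpha2.
Definition hom_coassoc2 : (C ⊗ C ⊗ C)%type -> (C ⊗ C ⊗ C ⊗ C ⊗ C)%type :=
  tensor_map (@tensor_assoc3 K C C C C) (@idfun C) \o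
  tensor_map (tensor_map alpha1 Delta) alpha2.
Definition hom_coassoc3 : (C ⊗ C ⊗ C)%type -> (C ⊗ C ⊗ C ⊗ C ⊗ C)%type :=
  @tensor_assoc3 K (C ⊗ C)%type C C C \o
  tensor_map (tensor_map alpha1 alpha2) Delta.

Definition totally_hom_coassociative : Prop :=
  hom_coassoc1 \o Delta =1 hom_coassoc2 \o Delta /\
  hom_coassoc2 \o Delta =1 hom_coassoc3 \o Delta.

Definition weak_totally_hom_coassociative : Prop :=
  hom_coassoc1 \o Delta =1 hom_coassoc3 \o Delta.

Definition partially_hom_coassociative : Prop :=
  (hom_coassoc1 \+ hom_coassoc2 \+ hom_coassoc3) \o Delta =1 \0.

End TernaryHomCoalgebras.

(* Main.v *)
Require Import Defs.
From HB Require Import structures.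
From mathcomp Require Import all_boot all_algebra.
From mathcomp Require Import boolp classical_sets.

Set Implicit Arguments.
Unset Strict Implicit.
Unset Printing Implicit Defensive.

Import GRing.Theory.
Local Open Scope ring_scope.

(** For covectors f1, ..., f5 write f1 ⊗ ... ⊗ f5 for the functional on the
    fivefold tensor power of A that multiplies their values. Evaluating one of
    the three hom-associativity products of f1, ..., f5 in the dual algebra at
    x gives the value of f1 ⊗ ... ⊗ f5 at the matching hom-coassociativity
    expression in Delta x: the product is the transpose of the iterated
    coproduct ([hom_assoc1_dual], [hom_assoc2_dual], [hom_assoc3_dual]). So each
    coalgebra axiom implies the algebra axiom at once, and the converse asks
    that the functionals f1 ⊗ ... ⊗ f5 detect every nonzero tensor.

    That holds in any dimension. A vector space is separated by its dual
    ([dual_separates]): a subspace maximal among those that miss x is a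
    hyperplane complementary to the line of x. Separation passes to tensor
    products ([separates_tensor]): if every f ⊗ id kills a sum of pure tensors,
    a nonzero first factor gives a linear relation between the second factors,
    which shortens the sum. Four applications reach the fivefold power
    ([dual_tensor5_separates]). *)

(** * Functionals separate the points of a vector space *)

Section PairingTheory.
Variables (K : fieldType) (V : lmodType K).
Implicit Types (f g : dual V) (x y : V).

Lemma pairing0 f : pairing f 0 = 0.
Proof. exact: (linear0 (f : {linear V -> K^o})). Qed.

Lemma pairingZ f a x : pairing f (a *: x) = a * pairing f x.
Proof. by rewrite -[a *: x]addr0 pairingPr pairing0 addr0. Qed.

Lemma pairingD f x y : pairing f (x + y) = pairing f x + pairing f y.
Proof. exact: (linearD (f : {linear V -> K^o})). Qed.

Lemma pairingB f x y : pairing f (x - y) = pairing f x - pairing f y.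
Proof. exact: (linearB (f : {linear V -> K^o})). Qed.

Lemma pairing_sum f (I : Type) (s : seq I) (x : I -> V) :
  pairing f (\sum_(i <- s) x i) = \sum_(i <- s) pairing f (x i).
Proof. exact: (linear_sum (f : {linear V -> K^o})). Qed.

Lemma pairingDl f g x : pairing (f + g) x = pairing f x + pairing g x.
Proof. by []. Qed.

End PairingTheory.

Section DualSeparates.
Variables (K : fieldType) (V : lmodType K).

Definition lin_closed (M : set V) : Prop :=
  forall a u v, M u -> M v -> M (a *: u + v).

(** Zorn's lemma, applied to the sets that are closed under linear combinations
    and miss x, gives M. Being closed in this sense does not force a set to
    contain 0: the union of the empty chain is empty. So 0 is obtained from
    maximality as well. *)
Lemma maximal_subspace_avoiding (x : V) : x != 0 -> exists M : set V,
  [/\ lin_closed M, M 0, ~ M x & forall y, exists a, M (y - a *: x)].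
Proof.
move=> x_neq0; pose P (M : set V) := lin_closed M /\ ~ M x.
have chain (F : set (set V)) : (F `<=` P)%classic -> total_on F subset ->
    P (\bigcup_(X in F) X)%classic.
  move=> FP Ftot; split; last by case=> X /FP [].
  move=> a u v [X FX Xu] [Y FY Yv].
  case: (Ftot X Y FX FY) => [XY|YX]; [exists Y|exists X] => //.
    by apply: (FP Y FY).1 => //; exact: XY.
  by apply: (FP X FX).1 => //; exact: YX.
have [M [[Mlin Mx] Mmax]] := Zorn_bigcup chain.
have maxP (B : set V) : (M `<=` B)%classic -> P B -> (B `<=` M)%classic.
  by move=> MB PB; apply: contrapT => nBM; apply: (Mmax B).
have M0 : M 0.
  apply: (maxP [set z | M z \/ z = 0]%classic); [by left| |by right].
  split=> [a u v [Mu|->] [Mv|->]|[//|/eqP]].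
  - by left; apply: Mlin.
  - have Muu : M (- 1 *: u + u) by apply: Mlin.
    rewrite scaleN1r addNr in Muu.
    by left; apply: Mlin.
  - by rewrite scaler0 add0r; left.
  - by right; rewrite scaler0 addr0.
  - by rewrite (negPf x_neq0).
have MZ a u : M u -> M (a *: u) by move=> Mu; rewrite -[_ *: _]addr0; exact: Mlin.
exists M; split=> // y; have [My|nMy] := pselect (M y).
  by exists 0; rewrite scale0r subr0.
(* By maximality, adjoining y to M must capture x. *)
have [[a [m [Mm xE]]]|nx] := pselect (exists a m, M m /\ x = m + a *: y).
  have a_neq0 : a != 0.
    by apply/eqP => a0; apply: Mx; rewrite xE a0 scale0r addr0.
  exists a^-1; rewrite xE scalerDr scalerA mulVf // scale1r opprD addrCA subrr.
  by rewrite addr0 -scaleNr; apply: MZ.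
case: nMy; apply: (maxP [set z | exists a m, M m /\ z = m + a *: y]%classic).
- by move=> m Mm; exists 0, m; rewrite scale0r addr0.
- split=> // c u v [a [m [Mm ->]]] [b [n [Mn ->]]].
  exists (c * a + b), (c *: m + n); split; first exact: Mlin.
  by rewrite scalerDr scalerA scalerDl addrACA.
- by exists 1, 0; rewrite scale1r add0r.
Qed.

(** The functional is the coordinate along x in the decomposition of V into a
    maximal M avoiding x and the line of x. The coordinate is unique because M
    contains no nonzero multiple of x, and uniqueness makes it linear. *)
Lemma exists_dual_neq0 (x : V) : x != 0 -> exists f : dual V, pairing f x != 0.
Proof.
move=> x_neq0; have [M [Mlin M0 Mx Mdec]] := maximal_subspace_avoiding x_neq0.
have MZ a u : M u -> M (a *: u) by move=> Mu; rewrite -[_ *: _]addr0; exact: Mlin.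
pose f y : K^o := sval (cid (Mdec y)).
have fP y : M (y - f y *: x) by rewrite /f; case: cid.
have coordE y a : M (y - a *: x) -> f y = a.
  move=> My; apply/eqP; rewrite -subr_eq0; apply: contrapT => /negP c_neq0.
  apply: Mx; have := MZ (f y - a)^-1 _ (Mlin (- 1) _ _ (fP y) My).
  rewrite scaleN1r opprB addrA subrK -scalerBl scalerA mulVf // scale1r.
  exact.
have f_lin : linear f.
  move=> a u v; apply: coordE.
  have := Mlin a _ _ (fP u) (fP v).
  by rewrite scalerBr scalerA addrACA -opprD -scalerDl.
pose F : {linear V -> K^o} := HB.pack f (GRing.isLinear.Build K V K^o _ f f_lin).
exists (F : dual_space V); rewrite /pairing /= (coordE x 1) ?oner_eq0 //.
by rewrite scale1r subrr.
Qed.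

Definition separates (I : Type) (F : I -> dual V) : Prop :=
  forall v, (forall i, pairing (F i) v = 0) -> v = 0.

Lemma dual_separates : separates (fun f : dual V => f).
Proof.
move=> v fv0; apply/eqP; apply: contrapT => /negP /exists_dual_neq0 [f].
by rewrite fv0 eqxx.
Qed.

End DualSeparates.

(** * Product functionals separate tensors *)

Section TensorSeparates.
Variables (K : fieldType) (V W : lmodType K).

Definition sum_tens (s : seq (V * W)) : (V ⊗ W)%type := \sum_(p <- s) p.1 ⊗ p.2.

Lemma sum_tens_surj (t : (V ⊗ W)%type) : exists s, t = sum_tens s.
Proof.
elim/tens_ind: t => [|a t1 t2 [s1 ->] [s2 ->]|u v].
- by exists [::]; rewrite /sum_tens big_nil.
- exists ([seq (a *: p.1, p.2) | p <- s1] ++ s2).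
  rewrite /sum_tens big_cat big_map scaler_sumr; congr (_ + _).
  by apply: eq_bigr => p _; rewrite linearZl.
- by exists [:: (u, v)]; rewrite /sum_tens big_seq1.
Qed.

(** The hypothesis says that f ⊗ id kills the sum, for each f in the family.
    If all f vanish on the first factor u of the leading term u ⊗ v, then u = 0
    and the term can be dropped. If some f does not vanish on u, the relation
    for f expresses v through the other second factors; substituting moves
    multiples of u into the other first factors and removes one term. *)
Lemma sum_tens_eq0 (I : Type) (F : I -> dual V) (s : seq (V * W)) :
  separates F -> (forall i, \sum_(p <- s) pairing (F i) p.1 *: p.2 = 0) ->
  sum_tens s = 0.
Proof.
move=> Fsep; have [n] := ubnP (size s).
elim: n s => // n IHn [|[u v] s] /= s_lt F0; first by rewrite /sum_tens big_nil.
rewrite /sum_tens big_cons /=.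
have [[i Fi_neq0]|Fu0] := pselect (exists i, pairing (F i) u != 0); last first.
  have u0 : u = 0.
    apply: Fsep => i; apply/eqP; apply: contrapT => /negP Fiu.
    by apply: Fu0; exists i.
  rewrite u0 linear0l add0r; apply: IHn => // i.
  by have := F0 i; rewrite big_cons /= u0 pairing0 scale0r add0r.
pose c (p : V * W) := - ((pairing (F i) u)^-1 * pairing (F i) p.1).
have vE : v = \sum_(p <- s) c p *: p.2.
  have := F0 i; rewrite big_cons /= => /(congr1 ( *:%R (pairing (F i) u)^-1)).
  rewrite scaler0 scalerDr scalerA mulVf // scale1r scaler_sumr => /eqP.
  rewrite addr_eq0 => /eqP ->; rewrite -sumrN; apply: eq_bigr => p _.
  by rewrite scalerA scaleNr.
pose s' := [seq (c p *: u + p.1, p.2) | p <- s].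
transitivity (sum_tens s').
  rewrite /sum_tens big_map [in LHS]vE linear_sum -big_split /=.
  by apply: eq_bigr => p _; rewrite tensPl linearZr.
apply: IHn => [|j]; first by rewrite size_map.
have := F0 j; rewrite big_cons /= [X in _ *: X + _]vE scaler_sumr -big_split /=.
rewrite big_map => E; rewrite -[RHS]E; apply: eq_bigr => p _ /=.
by rewrite pairingPr scalerDl scalerA mulrC.
Qed.

Definition prod_family (I J : Type) (F : I -> dual V) (G : J -> dual W)
    (ij : I * J) : dual (V ⊗ W)%type :=
  dual_tensor (F ij.1 ⊗ G ij.2).

(** Once f in the first family is fixed, the values of the second family at
    (f ⊗ id) t are the values of the product functionals at t. They all vanish,
    so (f ⊗ id) t = 0 and [sum_tens_eq0] applies. *)
Lemma separates_tensor (I J : Type) (F : I -> dual V) (G : J -> dual W) :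
  separates F -> separates G -> separates (prod_family F G).
Proof.
move=> Fsep Gsep t FG0; have [s tE] := sum_tens_surj t.
rewrite tE; apply: (sum_tens_eq0 Fsep) => i; apply: Gsep => j.
rewrite -[RHS](FG0 (i, j)) tE /prod_family /=.
rewrite !pairing_sum; apply: eq_bigr => p _.
by rewrite pairingZ dual_tensorE.
Qed.

End TensorSeparates.

(** * The products of the dual algebra are transposes *)

Section TernaryTensors.
Variables (K : fieldType) (U V W : lmodType K).

Lemma dual_tensor_ext3 (f g : dual (U ⊗ V ⊗ W)%type) :
  (forall u v w, pairing f (u ⊗ v ⊗ w) = pairing g (u ⊗ v ⊗ w)) -> f = g.
Proof.
move=> fg; apply: dual_tensor_ext => t w.
elim/tens_ind: t => [|a s t fgs fgt|u v]; last exact: fg.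
  by rewrite linear0l !pairing0.
by rewrite tensPl !pairingPr fgs fgt.
Qed.

(** The first factor U is arbitrary because reassociation occurs twice in the
    coassociativity maps: with U = A for the middle one, and with U = A ⊗ A for
    the last. *)
Lemma dual_tensor_assoc3 (X : lmodType K)
    (f : dual U) (g : dual V) (h : dual W) (k : dual X) u t :
  pairing (dual_tensor (dual_tensor (dual_tensor (f ⊗ g) ⊗ h) ⊗ k))
    (tensor_assoc3 (u ⊗ t)) =
  pairing f u * pairing (dual_tensor (dual_tensor (g ⊗ h) ⊗ k)) t.
Proof.
elim/tens_ind: t => [|a s t IHs IHt|t x]; first by rewrite !linear0 !pairing0 mulr0.
  by rewrite !linearP !pairingPr IHs IHt mulrDr mulrCA.
elim/tens_ind: t => [|a s t IHs IHt|v w].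
- by rewrite linear0l !linear0 !pairing0 mulr0.
- by rewrite tensPl !linearP !pairingPr IHs IHt mulrDr mulrCA.
- by rewrite tensor_assoc3E !dual_tensorE !mulrA.
Qed.

End TernaryTensors.

Section DualProducts.
Variables (K : fieldType) (A : lmodType K).
Variables (Delta : {linear A -> (A ⊗ A ⊗ A)%type}) (alpha1 alpha2 : {linear A -> A}).

(* Linearity lets functionals be pulled back along the coassociativity maps,
   so that identities need checking on pure tensors only. *)
HB.instance Definition _ := GRing.Linear.copy
  (hom_coassoc1 Delta alpha1 alpha2)
  (tensor_map (tensor_map Delta alpha1) alpha2).
HB.instance Definition _ := GRing.Linear.copy
  (hom_coassoc2 Delta alpha1 alpha2)
  (tensor_map (@tensor_assoc3 K A A A A) (@idfun A) \o
   tensor_map (tensor_map alpha1 Delta) alpha2).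
HB.instance Definition _ := GRing.Linear.copy
  (hom_coassoc3 Delta alpha1 alpha2)
  (@tensor_assoc3 K (A ⊗ A)%type A A A \o
   tensor_map (tensor_map alpha1 alpha2) Delta).

Definition dual_tensor5 (f1 f2 f3 f4 f5 : dual A) :
    dual (A ⊗ A ⊗ A ⊗ A ⊗ A)%type :=
  dual_tensor (dual_tensor (dual_tensor (dual_tensor (f1 ⊗ f2) ⊗ f3) ⊗ f4) ⊗ f5).

Lemma dual_tensor5_separates (t : (A ⊗ A ⊗ A ⊗ A ⊗ A)%type) :
  (forall f1 f2 f3 f4 f5, pairing (dual_tensor5 f1 f2 f3 f4 f5) t = 0) -> t = 0.
Proof.
move=> t0; have sepA := @dual_separates K A.
have sep5 := separates_tensor (separates_tensor
  (separates_tensor (separates_tensor sepA sepA) sepA) sepA) sepA.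
by apply: sep5 => -[[[[f1 f2] f3] f4] f5]; exact: t0.
Qed.

Lemma dual_tensor3_pure (f g h : dual A) :
  dual_tensor3 (f ⊗ g ⊗ h) = dual_tensor (dual_tensor (f ⊗ g) ⊗ h).
Proof. by rewrite /dual_tensor3 /= tensor_mapE. Qed.

Local Notation mu := (dual_comul Delta).
Local Notation a1 := (dual_map alpha1).
Local Notation a2 := (dual_map alpha2).

Lemma hom_assoc1_dual f1 f2 f3 f4 f5 x :
  pairing (hom_assoc1 mu a1 a2 f1 f2 f3 f4 f5) x =
  pairing (dual_tensor5 f1 f2 f3 f4 f5) (hom_coassoc1 Delta alpha1 alpha2 (Delta x)).
Proof.
rewrite /hom_assoc1 dual_comulE.
rewrite -[RHS](dual_mapE (hom_coassoc1 Delta alpha1 alpha2)).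
congr (pairing _ _); apply: dual_tensor_ext3 => y z w.
rewrite dual_tensor3E dual_comulE dual_tensor3_pure !dual_mapE.
by rewrite /= /hom_coassoc1 tensor_mapE /= tensor_mapE /dual_tensor5 !dual_tensorE.
Qed.

Lemma hom_assoc2_dual f1 f2 f3 f4 f5 x :
  pairing (hom_assoc2 mu a1 a2 f1 f2 f3 f4 f5) x =
  pairing (dual_tensor5 f1 f2 f3 f4 f5) (hom_coassoc2 Delta alpha1 alpha2 (Delta x)).
Proof.
rewrite /hom_assoc2 dual_comulE.
rewrite -[RHS](dual_mapE (hom_coassoc2 Delta alpha1 alpha2)).
congr (pairing _ _); apply: dual_tensor_ext3 => y z w.
rewrite dual_tensor3E dual_comulE dual_tensor3_pure !dual_mapE.
rewrite /= /hom_coassoc2 /= tensor_mapE /= tensor_mapE /= /dual_tensor5 dual_tensorE /=.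
by rewrite tensor_mapE dual_tensor_assoc3.
Qed.

Lemma hom_assoc3_dual f1 f2 f3 f4 f5 x :
  pairing (hom_assoc3 mu a1 a2 f1 f2 f3 f4 f5) x =
  pairing (dual_tensor5 f1 f2 f3 f4 f5) (hom_coassoc3 Delta alpha1 alpha2 (Delta x)).
Proof.
rewrite /hom_assoc3 dual_comulE.
rewrite -[RHS](dual_mapE (hom_coassoc3 Delta alpha1 alpha2)).
congr (pairing _ _); apply: dual_tensor_ext3 => y z w.
rewrite dual_tensor3E dual_comulE dual_tensor3_pure !dual_mapE.
rewrite /= /hom_coassoc3 /= tensor_mapE /= tensor_mapE /= /dual_tensor5.
by rewrite dual_tensor_assoc3 dual_tensorE.
Qed.

End DualProducts.

(** * Transfer of identities *)

Section Transfer.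
Variables (K : fieldType) (A : lmodType K).

(** The multilinear form of the statement that m is the transpose of T. *)
Definition transpose5 (m : dual A -> dual A -> dual A -> dual A -> dual A -> dual A)
    (T : A -> (A ⊗ A ⊗ A ⊗ A ⊗ A)%type) : Prop :=
  forall f1 f2 f3 f4 f5 x,
    pairing (m f1 f2 f3 f4 f5) x = pairing (dual_tensor5 f1 f2 f3 f4 f5) (T x).

Lemma transpose5_eq0 m T : transpose5 m T ->
  T =1 \0 <-> (forall f1 f2 f3 f4 f5, m f1 f2 f3 f4 f5 = 0).
Proof.
move=> mT; split=> [T0 f1 f2 f3 f4 f5|m0 x].
  by apply: dualP => x; rewrite mT T0 pairing0.
by apply: dual_tensor5_separates => f1 f2 f3 f4 f5; rewrite -mT m0.
Qed.

Lemma transpose5_eq m1 m2 T1 T2 : transpose5 m1 T1 -> transpose5 m2 T2 ->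
  T1 =1 T2 <-> (forall f1 f2 f3 f4 f5, m1 f1 f2 f3 f4 f5 = m2 f1 f2 f3 f4 f5).
Proof.
move=> mT1 mT2; split=> [T12 f1 f2 f3 f4 f5|m12 x].
  by apply: dualP => x; rewrite mT1 mT2 T12.
apply/eqP; rewrite -subr_eq0; apply/eqP.
apply: dual_tensor5_separates => f1 f2 f3 f4 f5.
by rewrite pairingB -mT1 -mT2 m12 subrr.
Qed.

End Transfer.

Theorem theorem2p7 (K : fieldType) (A : lmodType K)
    (Delta : {linear A -> (A ⊗ A ⊗ A)%type}) (alpha1 alpha2 : {linear A -> A}) :
  [pchar K] =i pred0 ->
  [/\ partially_hom_coassociative Delta alpha1 alpha2 <->
      partially_hom_associative
        (dual_comul Delta) (dual_map alpha1) (dual_map alpha2),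
      totally_hom_coassociative Delta alpha1 alpha2 <->
      totally_hom_associative
        (dual_comul Delta) (dual_map alpha1) (dual_map alpha2)
    & weak_totally_hom_coassociative Delta alpha1 alpha2 <->
      weak_totally_hom_associative
        (dual_comul Delta) (dual_map alpha1) (dual_map alpha2)].
Proof.
move=> _.
have t1 := @hom_assoc1_dual K A Delta alpha1 alpha2.
have t2 := @hom_assoc2_dual K A Delta alpha1 alpha2.
have t3 := @hom_assoc3_dual K A Delta alpha1 alpha2.
split.
- apply: transpose5_eq0 => f1 f2 f3 f4 f5 x.
  rewrite !pairingDl t1 t2 t3 /=.
  by rewrite !pairingD.
- have [co12 as12] := transpose5_eq t1 t2.
  have [co23 as23] := transpose5_eq t2 t3.
  split=> [[/co12 e12 /co23 e23] f1 f2 f3 f4 f5|e]; first by split.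
  by split; [apply: as12|apply: as23] => f1 f2 f3 f4 f5; have [] := e f1 f2 f3 f4 f5.
- exact: transpose5_eq t1 t3.
Qed.
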